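(* Let $\Omega\subset\mathbb{R}^n$ be a nonempty bounded open set and $K=\overline{\Omega}$. Let $D_1\subset K$ be a countable dense subset of $K$, let $D_2\subset K\setminus D_1$ be a countable set that is dense in $K$, and let $\{(x_j,y_j)\}_{j\in\mathbb{N}}$ be an enumeration of $D_1\times D_2$ (so that $x_j\neq y_j$ for all $j$). For $j\in\mathbb{N}$ define the measure $$\mu_j=\frac{\delta_{x_j}-\delta_{y_j}}{|x_j-y_j|}\in\mathfrak{M}_0(K).$$ Then there exists a constant $C\in(0,1)$ such that for any $\mu\in\mathfrak{M}_0(K)^c$ there exists a sequence $(\alpha_j)_{j\in\mathbb{N}}\in\ell^1(\mathbb{R})$ such that $$\mu=\sum_{j=1}^{+\infty}\frac{\delta_{x_j}-\delta_{y_j}}{|x_j-y_j|}\,\alpha_j,$$ where the series converges in the norm $\|\cdot\|_{KR_0}$, and $$C\sum_{j=1}^{+\infty}|\alpha_j|\le\|\mu\|_{KR_0}\le\sum_{j=1}^{+\infty}|\alpha_j|.$$ Moreover, the sequence of $\delta$-atoms $(\mu_j)_{j\in\mathbb{N}}$ spans $\mathfrak{M}_0(K)^c$ (that is, its closed linear span is $\mathfrak{M}_0(K)^c$), and $\|\mu_j\|_{KR_0}=1$ for any $j\in\mathbb{N}$. In particular the $\delta$-atoms $\mu_j$ are dipoles, hence have support of cardinality exactly $2$.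
   Context: $|\cdot|$ is the Euclidean norm on $\mathbb{R}^n$, and $\delta_x$ is the Dirac measure at $x$. $\mathfrak{M}(K)$ is the space of finite signed Borel measures on $K$, and $\mathfrak{M}_0(K)=\{\mu\in\mathfrak{M}(K):\mu(K)=0\}$. For $\mu\in\mathfrak{M}_0(K)$ let $\Psi_\mu$ be the set of finite positive Borel measures $\Psi$ on $K\times K$ with $\Psi(K\times E)-\Psi(E\times K)=\mu(E)$ for every Borel set $E\subset K$, and define the Kantorovich-Rubinstein norm $$\|\mu\|_{KR_0}=\inf\left\{\int_{K\times K}|x-y|\,d\Psi(x,y):\ \Psi\in\Psi_\mu\right\}.$$ $\mathfrak{M}_0(K)^c$ denotes the completion of $(\mathfrak{M}_0(K),\|\cdot\|_{KR_0})$, with the extended norm still denoted $\|\cdot\|_{KR_0}$; $\mathfrak{M}_0(K)$ is regarded as a subspace of its completion. A $\delta$-atom is a measure in $\mathfrak{M}(K)$ with finite support. A dipole is a measure in $\mathfrak{M}_0(K)$ of the form $\alpha(\delta_x-\delta_y)$ with $\alpha\in\mathbb{R}$ and $(x,y)\in K^2$. *)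

(* Defs.v *)
From HB Require Import structures.
From mathcomp Require Import all_boot all_order all_algebra.
From mathcomp Require Import all_classical all_reals all_analysis.

Set Implicit Arguments.
Unset Strict Implicit.
Unset Printing Implicit Defensive.

Import Order.TTheory GRing.Theory Num.Theory.
Import numFieldNormedType.Exports.

Local Open Scope classical_set_scope.
Local Open Scope ring_scope.

(* The library norm on ['rV[R]_n] is the sup norm, hence the following. *)
Definition euclid_dist (R : realType) (n : nat) (x y : 'rV[R]_n) : R :=
  Num.sqrt (\sum_(i < n) (x ord0 i - y ord0 i) ^+ 2).

Section closure_type.
Context (R : realType) (n : nat) (Omega : set 'rV[R]_n).

(* K, the closure of Omega, as a type with the topology induced by R^n.  The
   proof of nonemptiness is a parameter because measurable types are pointed. *)
Definition closure_type (Omega0 : Omega !=set0) : Type := closure Omega.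

Variable Omega0 : Omega !=set0.

HB.instance Definition _ :=
  Topological.copy (closure_type Omega0) (set_type (closure Omega)).

Let point_of : closure_type Omega0 :=
  exist _ (projT1 (cid Omega0))
    (mem_set (@subset_closure _ Omega _ (projT2 (cid Omega0)))).

HB.instance Definition _ := isPointed.Build (closure_type Omega0) point_of.

Definition kdist (x y : closure_type Omega0) : R :=
  euclid_dist (\val x) (\val y).

End closure_type.

Notation borel T := (g_sigma_algebraType (@open T)).

Section kantorovich_rubinstein.
Context (R : realType) (T : ptopologicalType) (dist : T -> T -> R).

Local Notation M := (charge (borel T) R).

Definition M0 : set M := [set mu | mu setT = 0%E].

Definition plans (mu : M) :
    set {finite_measure set (borel (T * T)%type) -> \bar R} :=
  [set Psi | forall E : set (borel T), measurable E ->
     (Psi (setT `*` E) - Psi (E `*` setT))%E = mu E].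

Definition KR (mu : M) : \bar R :=
  ereal_inf [set (\int[Psi]_p (dist p.1 p.2)%:E)%E | Psi in plans mu].

(* [iota] exhibits the Banach space [V] as the completion of M0 for the norm
   KR; its values outside M0 are irrelevant.  Charges are functions on all
   sets, so distinct terms may denote the same Borel measure: they have the
   same image since [iota] is linear and isometric. *)
Record KR_completion (V : completeNormedModType R) (iota : M -> V) : Prop := {
  KR_completionD : forall mu nu, M0 mu -> M0 nu ->
    iota (cadd mu nu) = iota mu + iota nu ;
  KR_completionZ : forall (a : R) mu, M0 mu ->
    iota (cscale a mu) = a *: iota mu ;
  KR_completion_norm : forall mu, M0 mu -> (`|iota mu|)%:E = KR mu ;
  KR_completion_dense : dense (iota @` M0) }.

Definition delta (x : T) : M :=
  charge_of_finite_measure (dirac (x : borel T) : {finite_measure set _ -> \bar R}).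

Definition dipole (a : R) (x y : T) : M :=
  cscale a (cadd (delta x) (copp (delta y))).

Definition is_dipole (mu : M) : Prop :=
  M0 mu /\ exists a x y, forall E : set (borel T), measurable E ->
    mu E = dipole a x y E.

(* Complement of the largest open set on which the total variation of [mu]
   vanishes. *)
Definition supp (mu : M) : set T :=
  [set x | forall U : set T, open U -> U x -> ~ mu.-null_set U].

Definition is_delta_atom (mu : M) : Prop := finite_set (supp mu).

End kantorovich_rubinstein.

Definition linear_span (R : realType) (V : lmodType R) (A : set V) : set V :=
  [set v | exists N (c : 'I_N -> R) (a : 'I_N -> V),
     (forall i, A (a i)) /\ v = \sum_(i < N) c i *: a i].

(* Main.v *)
Require Import Defs.
From HB Require Import structures.
From mathcomp Require Import all_boot all_order all_algebra finmap.
From mathcomp Require Import all_classical all_reals all_analysis.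
From mathcomp Require Import measurable_realfun ring lra.

Set Implicit Arguments.
Unset Strict Implicit.
Unset Printing Implicit Defensive.

Import Order.TTheory GRing.Theory Num.Theory.
Import numFieldNormedType.Exports.

Local Open Scope classical_set_scope.
Local Open Scope ring_scope.

(* Cut K x K into finitely many small cells.  Replacing each pair of a nearly
   optimal plan Psi of mu by a nearby pair (y_k, x_k) turns Psi into a nonnegative
   combination of the mu_k that is close to mu and whose coefficients sum up to at
   most about the cost of Psi.  Hence every v in the completion is within any e > 0
   of a finite combination of the mu_k with coefficients of total size at most
   |v| + e, and iterating on the residuals gives an l^1 representation of v; this
   yields C = 1/2 (any C < 1 could be reached).  The bound KR(mu_j) >= 1 is the
   easy half of Kantorovich duality, with a truncated distance as test function. *)

(* Joins the pointed and topological structures on products, so that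
   [borel (T * T)] is covered by the lemmas on a [ptopologicalType]. *)
HB.instance Definition _ (S T : ptopologicalType) := Pointed.on (S * T)%type.

(** * Tools: sums of push-forward measures, and l^1 expansions in a normed space *)

Definition pushforward_measure d1 d2 (T1 : measurableType d1)
    (T2 : measurableType d2) (R : realFieldType)
    (mu : {measure set T1 -> \bar R}) (f : T1 -> T2)
    (mf : measurable_fun setT f) : {measure set T2 -> \bar R} :=
  measure_function_pushforward__canonical__measure_function_Measure mu mf.

Section pushforward_add.
Context d1 d2 (T1 : measurableType d1) (T2 : measurableType d2) (R : realType).
Variables (mu : {finite_measure set T1 -> \bar R}) (f g : T1 -> T2).

Definition pushforward_add (mf : measurable_fun setT f)
    (mg : measurable_fun setT g) : set T2 -> \bar R :=
  measure_add (pushforward_measure mu mf) (pushforward_measure mu mg).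

Variables (mf : measurable_fun setT f) (mg : measurable_fun setT g).

HB.instance Definition _ := Measure.on (pushforward_add mf mg).

Lemma pushforward_addE A :
  pushforward_add mf mg A = (mu (f @^-1` A) + mu (g @^-1` A))%E.
Proof. by rewrite /pushforward_add measure_addE. Qed.

Let pushforward_add_fin : fin_num_fun (pushforward_add mf mg).
Proof.
move=> A mA; rewrite pushforward_addE fin_numD !fin_num_measure//.
- by rewrite -[X in measurable X]setTI; exact: mg.
- by rewrite -[X in measurable X]setTI; exact: mf.
Qed.

HB.instance Definition _ :=
  Measure_isFinite.Build _ _ _ (pushforward_add mf mg) pushforward_add_fin.

End pushforward_add.

(* Greedy iteration: the residual [r k] shrinks by a factor 4 at each step, and
   the coefficients used at the successive steps add up in l^1. *)
Lemma l1_representation (R : realType) (V : normedModType R) (m : nat -> V) :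
  (forall j, `|m j| <= 1) ->
  (forall (v : V) (e : R), 0 < e -> exists (N : nat) (c : nat -> R),
     [/\ forall j, (N <= j)%N -> c j = 0,
         \sum_(0 <= j < N) `|c j| <= `|v| + e
       & `|v - \sum_(0 <= j < N) c j *: m j| <= e]) ->
  forall v : V, exists a : nat -> R,
    [/\ cvgn (series (fun j => `|a j|)),
        series (fun j => a j *: m j) @ \oo --> v
      & limn (series (fun j => `|a j|)) <= 2 * `|v| ].
Proof.
move=> m1 approx v.
(* The tolerances [e k] below are multiples of [|v|], so they are positive only for nonzero [v]. *)
have [->|v0] := eqVneq v 0.
  have s0 : series (fun j : nat => `|(0 : R)|) = fun=> 0.
    by apply/funext => n; rewrite /series/= big1// => i _; rewrite normr0.
  exists (fun=> 0); split.
  - by rewrite s0; exact: is_cvg_cst.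
  - have -> : series (fun j => 0 *: m j) = fun=> 0.
      by apply/funext => n; rewrite /series/= big1// => i _; rewrite scale0r.
    exact: cvg_cst.
  - by rewrite s0 lim_cst// normr0 mulr0.
pose D : R := `|v|; have D0 : 0 < D by rewrite normr_gt0.
have /choice[ch chP] : forall p : V * R, exists q : nat * (nat -> R),
    0 < p.2 -> [/\ forall j, (q.1 <= j)%N -> q.2 j = 0,
         \sum_(0 <= j < q.1) `|q.2 j| <= `|p.1| + p.2
       & `|p.1 - \sum_(0 <= j < q.1) q.2 j *: m j| <= p.2].
  move=> [w e]/=; case: (ltP 0 e) => [e0|e0]; last by exists (0%N, fun=> 0).
  by have [N [c H]] := approx w e e0; exists (N, c).
pose t k : R := 4%:R^-1 ^+ k.
have t0 k : 0 < t k by rewrite exprn_gt0.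
have tS k : t k.+1 = t k / 4 by rewrite /t exprSr.
(* With tolerance [D / 4^(k+1)], step [k] spends at most [|r k| + e k <= (5/4) D / 4^k]; these
   bounds add up to [(5/3) D], below the target [2 D]. *)
pose e k : R := D * t k.+1.
have e0 k : 0 < e k by rewrite mulr_gt0.
pose N w k := (ch (w, e k)).1.
pose r := nat_rect (fun=> V) v
  (fun k w => w - \sum_(0 <= j < N w k) (ch (w, e k)).2 j *: m j).
pose C k := (ch (r k, e k)).2.
have CP k := chP (r k, e k) (e0 k).
have C0 k j : (N (r k) k <= j)%N -> C k j = 0 by have [/(_ j)] := CP k.
have rS k : r k.+1 = r k - \sum_(0 <= j < N (r k) k) C k j *: m j by [].
have rD k : `|r k| <= D * t k.
  case: k => [|k]; first by rewrite /t expr0 mulr1.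
  by have [_ _] := CP k.
(* The coefficients of a step vanish from its own [N] on, so different steps can be summed over a
   common range [M]. *)
have sumC k (f : nat -> R -> V) M : (forall j, f j 0 = 0) ->
    (N (r k) k <= M)%N ->
    \sum_(0 <= j < M) f j (C k j) = \sum_(0 <= j < N (r k) k) f j (C k j).
  move=> f0 NM; rewrite (big_cat_nat (leq0n _) NM)//= [X in _ + X]big1_seq ?addr0// => j.
  by rewrite mem_index_iota => /andP[_ /andP[Nj _]]; rewrite C0.
have CD k M : \sum_(0 <= j < M) `|C k j| <= 5 / 4 * D * t k.
  have -> : 5 / 4 * D * t k = D * t k + e k by rewrite /e tS; field.
  have CN : \sum_(0 <= j < N (r k) k) `|C k j| <= `|r k| + e k by have [] := CP k.
  apply: (@le_trans _ _ (\sum_(0 <= j < N (r k) k) `|C k j|)).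
    have [NM|MN] := leqP (N (r k) k) M.
      rewrite (big_cat_nat (leq0n _) NM)//= [X in _ + X]big1_seq ?addr0// => j.
      by rewrite mem_index_iota => /andP[_ /andP[Nj _]]; rewrite C0// normr0.
    by rewrite [leRHS](big_cat_nat (leq0n _) (ltnW MN))//= lerDl sumr_ge0.
  by rewrite (le_trans CN)// lerD2r rD.
(* Total coefficient given to [m j] by the first [k] steps; its limit in [k] is the coefficient
   sought. *)
pose A k j := \sum_(0 <= i < k) C i j.
have vA k : exists M0, forall M, (M0 <= M)%N ->
    v = r k + \sum_(0 <= j < M) A k j *: m j.
  elim: k => [|k [M0 IH]].
    by exists 0%N => M _; rewrite big1 ?addr0// => j _; rewrite /A big_nil scale0r.
  exists (maxn M0 (N (r k) k)) => M; rewrite geq_max => /andP[M0M NM].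
  rewrite rS -(sumC k (fun j x => x *: m j) M)// => [|j]; last by rewrite scale0r.
  rewrite {1}(IH _ M0M) -addrA; congr (_ + _); rewrite addrC -sumrB.
  by apply: eq_bigr => j _; rewrite /A big_nat_recr//= scalerDl addrK.
(* A geometric sum of the bounds [CD]. It is uniform in [M], which lets [L] and then [M] tend to
   infinity. *)
have AD K L M : (K <= L)%N ->
    \sum_(0 <= j < M) `|A L j - A K j| <= 5 / 3 * D * (t K - t L).
  move=> /subnKC <-; elim: (L - K)%N => [|d IH].
    rewrite addn0 subrr mulr0 big1// => j _; rewrite subrr normr0//.
  rewrite addnS tS; apply: (@le_trans _ _ (\sum_(0 <= j < M)
      (`|A (K + d)%N j - A K j| + `|C (K + d)%N j|))).
    apply: ler_sum => j _; rewrite /A big_nat_recr//= addrAC.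
    exact: ler_normD.
  rewrite big_split/= (le_trans (lerD IH (CD _ _)))//.
  by rewrite le_eqVlt; apply/orP; left; apply/eqP; field.
(* For fixed [j], [|C k j|] is one term of the sum in [CD], hence dominated by a geometric
   series. *)
have cA j : cvgn (A ^~ j).
  have -> : A ^~ j = series (C ^~ j) by [].
  apply: (@normed_cvg R R).
  apply: (@series_le_cvg _ _ (geometric (5 / 4 * D) 4^-1)) => //.
  - by move=> n /=.
  - by move=> n; apply: mulr_ge0; rewrite ?exprn_ge0// mulr_ge0// ltW.
  - move=> k; apply: le_trans (CD k j.+1).
    by rewrite big_nat_recr//= lerDr sumr_ge0.
  - apply: is_cvg_geometric_series.
    by rewrite ger0_norm ?invr_ge0// invf_lt1// ltr1n.
pose a j := limn (A ^~ j).
have aD K M : \sum_(0 <= j < M) `|a j - A K j| <= 5 / 3 * D * t K.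
  have cv : (fun L => \sum_(0 <= j < M) `|A L j - A K j|) @ \oo -->
      \sum_(0 <= j < M) `|a j - A K j|.
    elim: M => [|M IH].
      by rewrite big_nil; under eq_fun do rewrite big_nil; exact: cvg_cst.
    under eq_fun do rewrite big_nat_recr//=; rewrite big_nat_recr//=.
    apply: cvgD => //; apply: cvg_norm; apply: cvgB; last exact: cvg_cst.
    exact: cA.
  rewrite -(cvg_lim _ cv)//; apply: limr_le; first by apply/cvg_ex; eexists; exact: cv.
  near=> L; apply: (le_trans (AD K L M _)); first by near: L; exact: nbhs_infty_ge.
  by rewrite ler_pM2l ?mulr_gt0// gerBl ltW.
have aN M : \sum_(0 <= j < M) `|a j| <= 5 / 3 * D.
  have := aD 0%N M; rewrite /t expr0 mulr1; apply: le_trans.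
  by apply: ler_sum => j _; rewrite [A 0%N j]big_nil subr0.
have ca : cvgn (series (fun j => `|a j|)).
  apply: nondecreasing_is_cvgn; first by apply: nondecreasing_series.
  by exists (5 / 3 * D) => _ [M _ <-]; exact: aN.
exists a; split => //.
(* For large [M], [v] minus the partial sum is [r K] plus the combination with coefficients
   [A K j - a j], of norm at most [(1 + 5/3) D / 4^K]. *)
- apply/cvgrPdist_le => eps eps0.
  have : (fun k => (8 / 3 * D) * t k) @ \oo --> (8 / 3 * D) * 0.
    apply: cvgM; first exact: cvg_cst.
    by apply: cvg_expr; rewrite ger0_norm ?invr_ge0// invf_lt1// ltr1n.
  move/cvgrPdist_le => /(_ _ eps0)[K _ /(_ K (leqnn _))].
  rewrite mulr0 sub0r normrN ger0_norm; last first.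
    by rewrite mulr_ge0 ?(ltW (t0 _))// mulr_ge0// ltW.
  move=> tK; have [M0 HM] := vA K.
  exists M0 => // M M0M; apply: le_trans tK.
  rewrite {1}(HM _ M0M) /series/= -addrA -sumrB.
  apply: (le_trans (ler_normD _ _)).
  have -> : 8 / 3 * D * t K = D * t K + 5 / 3 * D * t K by field.
  apply: lerD => //; apply: le_trans (aD K M).
  apply: (le_trans (ler_norm_sum _ _ _)); apply: ler_sum => j _.
  by rewrite -scalerBl normrZ distrC ler_piMr.
- apply: limr_le => //; near=> M; apply: (le_trans (aN M)).
  by rewrite ler_wpM2r ?ltW//; lra.
Unshelve. all: by end_near. Qed.

(** * Borel measurability of continuous and piecewise continuous maps *)

Lemma open_borel (T : ptopologicalType) (U : set T) :
  open U -> measurable (U : set (borel T)).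
Proof. exact: sub_sigma_algebra. Qed.

Lemma measurable_fun_borel (S T : ptopologicalType) (f : S -> T) :
  (forall U : set T, open U -> measurable (f @^-1` U : set (borel S))) ->
  measurable_fun setT (f : borel S -> borel T).
Proof.
move=> mf; apply: (@measurability _ _ (borel S) (borel T) setT f (@open T)) => // _ [U oU <-].
by rewrite setTI; exact: mf.
Qed.

Lemma continuous_measurable_borel (S T : ptopologicalType) (f : S -> T) :
  continuous f -> measurable_fun setT (f : borel S -> borel T).
Proof.
move=> /continuousP cf; apply: measurable_fun_borel => U oU.
by apply: open_borel; exact: cf.
Qed.

Lemma continuous_measurable_EFin (R : realType) (S : ptopologicalType)
    (f : S -> R) :
  continuous f -> measurable_fun setT (fun p : borel S => (f p)%:E).
Proof.
move=> /continuousP cf; apply/measurable_EFinP.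
apply: (measurability _ (RGenOpens.measurableE R)).
move=> _ [_ [a [b ->] <-]]; rewrite setTI; apply: open_borel; apply: cf; exact: interval_open.
Qed.

(** Serves for maps given by a continuous formula on each cell of a countable measurable partition,
    [k p] being the index of the cell of [p]: a preimage is the union of its traces on the cells. *)
Lemma measurable_fun_glue (S T : ptopologicalType) (k : S -> nat)
    (h : nat -> S -> T) :
  (forall i, measurable ([set p | k p = i] : set (borel S))) ->
  (forall i, continuous (h i)) ->
  measurable_fun setT ((fun p => h (k p) p) : borel S -> borel T).
Proof.
move=> mk ch; apply: measurable_fun_borel => U oU.
rewrite (_ : _ @^-1` U = \bigcup_i ([set p | k p = i] `&` h i @^-1` U)).
  apply: bigcupT_measurable => i; apply: measurableI; first exact: mk.
  by apply: open_borel; move/continuousP: (ch i); exact.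
apply/seteqP; split=> [p Up|p [i _ [<-]]]//.
by exists (k p).
Qed.

(** * Transport plans and the KR norm for a continuous pseudometric *)

Record continuous_metric (R : realType) (T : ptopologicalType)
    (dist : T -> T -> R) : Prop := {
  dist_refl : forall x, dist x x = 0 ;
  dist_sym : forall x y, dist x y = dist y x ;
  dist_triangle : forall x y z, dist x z <= dist x y + dist y z ;
  dist_continuous : continuous (fun p : T * T => dist p.1 p.2) }.

Section transport.
Context (R : realType) (T : ptopologicalType) (dist : T -> T -> R).
Context (cm : continuous_metric dist).

Local Notation M := (charge (borel T) R).

Lemma dist_ge0 x y : 0 <= dist x y.
Proof.
have := dist_triangle cm x y x.
by rewrite (dist_refl cm) (dist_sym cm y x) -mulr2n pmulrn_lge0.
Qed.

Lemma measurable_dist :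
  measurable_fun setT (fun p : borel (T * T)%type => (dist p.1 p.2)%:E).
Proof. 
exact: (@continuous_measurable_EFin R (T * T)%type (fun p => dist p.1 p.2)
  (dist_continuous cm)). Qed.

Lemma dist_continuousl y : continuous (dist ^~ y).
Proof.
move=> z; apply: (@continuous_comp _ _ _ (fun z => (z, y))
  (fun p : T * T => dist p.1 p.2)); last exact: (dist_continuous cm).
by apply: cvg_pair; [exact: cvg_id|exact: cvg_cst].
Qed.

Lemma dist_continuousr x : continuous (dist x).
Proof.
rewrite (_ : dist x = dist ^~ x); first exact: dist_continuousl.
by apply/funext => z; exact: (dist_sym cm).
Qed.

Lemma measurable_fst_borel :
  measurable_fun setT (fst : borel (T * T)%type -> borel T).
Proof. by apply: continuous_measurable_borel => z; exact: cvg_fst. Qed.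

Lemma measurable_snd_borel :
  measurable_fun setT (snd : borel (T * T)%type -> borel T).
Proof. by apply: continuous_measurable_borel => z; exact: cvg_snd. Qed.

Lemma dipoleE a x y (E : set (borel T)) :
  dipole a x y E =
  (a%:E * ((\d_(x : borel T) E : \bar R) - \d_(y : borel T) E))%E.
Proof. by []. Qed.

Lemma dipole_M0 a x y : M0 (dipole a x y : M).
Proof. by rewrite /M0/= dipoleE !diracT subee// mule0. Qed.

Lemma KR_le (mu : M) Psi : plans mu Psi ->
  (KR dist mu <= \int[Psi]_p (dist p.1 p.2)%:E)%E.
Proof. by move=> pPsi; apply: ereal_inf_lbound; exists Psi. Qed.

Lemma KR_dipole_le (a : R) x y : 0 <= a ->
  (KR dist (dipole a x y) <= (a * dist x y)%:E)%E.
Proof.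
(* The marginal condition reads second minus first, so the mass [a] travels from [y] to [x]. *)
move=> a0; pose Psi : {finite_measure set (borel (T * T)%type) -> \bar R} :=
  mscale (NngNum a0) (\d_((y, x) : borel (T * T)%type)).
have pPsi : plans (dipole a x y) Psi.
  have PsiE A : Psi A = (a%:E * \d_((y, x) : borel (T * T)%type) A)%E by [].
  move=> E mE; rewrite dipoleE !PsiE !diracE muleBr//.
  by congr (_ * (_%:R)%:E - _ * (_%:R)%:E)%E; congr nat_of_bool; apply/idP/idP;
    rewrite !inE/= => // -[].
apply: (le_trans (KR_le pPsi)).
rewrite ge0_integral_mscale//; first last.
- by move=> p _; rewrite lee_fin dist_ge0.
- exact: measurable_dist.
rewrite integral_dirac//; last exact: measurable_dist.
by rewrite diracT mul1e -EFinM/= (dist_sym cm).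
Qed.

(* Duality with the 1-Lipschitz function [min (dist z y) (dist x y)], truncated
   so as to be integrable. *)
Lemma KR_dipole_ge (a : R) x y : 0 <= a ->
  ((a * dist x y)%:E <= KR dist (dipole a x y))%E.
Proof.
move=> a0; apply: le_ereal_inf_tmp => _ [Psi pPsi <-].
pose f z := Num.min (dist z y) (dist x y).
have f0 z : 0 <= f z by rewrite /f le_min !dist_ge0.
have cf : continuous f.
  by move=> z; apply: continuous_min; [exact: dist_continuousl|exact: cvg_cst].
have mf : measurable_fun setT (fun z : borel T => (f z)%:E).
  exact: continuous_measurable_EFin.
have mff : measurable_fun setT
    (fun p : borel (T * T)%type => (f (p.1 : borel T))%:E).
  exact: (measurableT_comp mf measurable_fst_borel).
have mfs : measurable_fun setT
    (fun p : borel (T * T)%type => (f (p.2 : borel T))%:E).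
  exact: (measurableT_comp mf measurable_snd_borel).
pose n1 : {measure set (borel T) -> \bar R} :=
  pushforward_measure Psi measurable_fst_borel.
pose n2 : {measure set (borel T) -> \bar R} :=
  pushforward_measure Psi measurable_snd_borel.

pose ma z : {measure set (borel T) -> \bar R} :=
  mscale (NngNum a0) (\d_(z : borel T)).
have maE z E : ma z E = (a%:E * \d_(z : borel T) E)%E by [].
(* The marginal identity, rearranged so that both sides are positive measures and can be
   integrated. *)
have n12 : (\int[measure_add n2 (ma y)]_z (f z)%:E =
            \int[measure_add n1 (ma x)]_z (f z)%:E)%E.
  apply: eq_measure_integral => E mE _.
  apply: etrans (measure_addE n2 (ma y) E) _.
  apply: etrans _ (esym (measure_addE n1 (ma x) E)); rewrite !maE.
  have n1E : n1 E = Psi (E `*` setT).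
    by congr (Psi _); apply/seteqP; split=> [p /= //|p []//].
  have n2E : n2 E = Psi (setT `*` E).
    by congr (Psi _); apply/seteqP; split=> [p /= //|p []//].
  have n1fin : n1 E \is a fin_num.
    apply: fin_num_measure; rewrite -[X in measurable X]setTI.
    exact: measurable_fst_borel.
  have n2fin : n2 E \is a fin_num.
    apply: fin_num_measure; rewrite -[X in measurable X]setTI.
    exact: measurable_snd_borel.
  have := pPsi E mE; rewrite -n1E -n2E dipoleE.
  rewrite -(fineK n1fin) -(fineK n2fin) !diracE -!EFinB -!EFinM -!EFinD.
  by move=> [H]; congr (_%:E); rewrite mulrBr in H; lra.
have fI m (z : T) : (\int[measure_add m (ma z)]_z (f z)%:E =
    \int[m]_z (f z)%:E + (a * f z)%:E)%E.
  rewrite ge0_integral_measure_add//; last by move=> t _; rewrite lee_fin.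
  rewrite ge0_integral_mscale//; last by move=> t _; rewrite lee_fin.
  by rewrite integral_dirac// diracT mul1e.
have fx : f x = dist x y by rewrite /f minxx.
have fy : f y = 0 by rewrite /f (dist_refl cm); apply/min_idPl; exact: dist_ge0.
move: n12; rewrite !fI fx fy mulr0 adde0.
have -> : (\int[n1]_z (f z)%:E = \int[Psi]_p (f p.1)%:E)%E.
  apply: (ge0_integral_pushforward measurable_fst_borel) => // z _.
  by rewrite lee_fin.
have -> : (\int[n2]_z (f z)%:E = \int[Psi]_p (f p.2)%:E)%E.
  apply: (ge0_integral_pushforward measurable_snd_borel) => // z _.
  by rewrite lee_fin.
move=> n12.
(* Finiteness, from the bound [f <= dist x y], permits the cancellation below. *)
have Ifin : (\int[Psi]_p (f p.1)%:E)%E \is a fin_num.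
  rewrite ge0_fin_numE; last by apply: integral_ge0 => p _; rewrite lee_fin.
  apply: (@le_lt_trans _ _ (\int[Psi]_p (cst (dist x y)%:E p))%E).
    apply: ge0_le_integral => //.
    - by move=> p _; rewrite lee_fin.
    - by move=> p _; rewrite lee_fin /f ge_min lexx orbT.
  rewrite integral_cst// lte_mul_pinfty ?lee_fin ?dist_ge0//.
  by rewrite ltey_eq fin_num_measure.
(* By [n12], adding the integral of [f p.1] to both sides turns the claim into the integrated
   Lipschitz bound [f p.2 <= f p.1 + dist p.1 p.2]. *)
rewrite -(leeD2lE _ _ Ifin) -n12 -ge0_integralD//; first last.
- exact: measurable_dist.
- by move=> p _; rewrite lee_fin dist_ge0.
- by move=> p _; rewrite lee_fin.
apply: ge0_le_integral => //.
- by move=> p _; rewrite lee_fin.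
- apply: emeasurable_funD => //; exact: measurable_dist.
- move=> p _; rewrite -EFinD lee_fin /f.
  have := dist_triangle cm p.2 p.1 y; have := dist_ge0 p.1 p.2.
  rewrite (dist_sym cm p.2 p.1).
  case: (leP (dist p.2 y) (dist x y)); case: (leP (dist p.1 y) (dist x y)); lra.
Qed.

Lemma KR_dipole (a : R) x y : 0 <= a ->
  KR dist (dipole a x y) = (a * dist x y)%:E.
Proof.
by move=> a0; apply/eqP; rewrite eq_le KR_dipole_le ?KR_dipole_ge.
Qed.

(* Round the transported pairs [p] to the pairs [(y k, x k)] nearby: the plan
   moves [x k] to [p.2] and [p.1] to [y k] at total cost [2 del * Psi setT]. *)
Lemma plan_discretize (mu : M) Psi (del : R) (N : nat) (x y : nat -> T) :
  0 < del -> plans mu Psi ->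
  (forall p : T * T, exists k, [/\ (k < N)%N, dist (x k) p.2 < del
                                 & dist p.1 (y k) < del]) ->
  exists b : nat -> R, [/\ forall k, 0 <= b k,
    ((\sum_(0 <= k < N) b k * dist (x k) (y k))%:E <=
       \int[Psi]_p (dist p.1 p.2)%:E + (2 * del)%:E * Psi setT)%E
    & forall nu : M,
        (forall E : set (borel T), measurable E ->
           nu E = (mu E - \sum_(0 <= k < N)
             (b k)%:E * ((\d_(x k : borel T) E : \bar R) - \d_(y k : borel T) E))%E) ->
        (KR dist nu <= (2 * del)%:E * Psi setT)%E].
Proof.
move=> del0 pPsi cov.
(* [U k] collects the pairs that may be rounded to [(y k, x k)]; [seqDU] then makes the cells
   disjoint, each pair going to the first one that contains it. *)
pose U k := [set p : T * T | dist (x k) p.2 < del /\ dist p.1 (y k) < del].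
have oU k : open (U k).
  rewrite (_ : U k = ((fun p : T * T => dist (x k) p.2) @^-1` [set r | r < del])
     `&` ((fun p : T * T => dist p.1 (y k)) @^-1` [set r | r < del]))//.
  apply: openI; apply: open_comp; try exact: open_lt; move=> p _.
  - apply: (@continuous_comp _ _ _ snd (dist (x k))); first exact: cvg_snd.
    exact: dist_continuousr.
  - apply: (@continuous_comp _ _ _ fst (dist ^~ (y k))); first exact: cvg_fst.
    exact: dist_continuousl.
pose A : nat -> set (borel (T * T)%type) := seqDU U.
have AU k p : A k p -> dist (x k) p.2 < del /\ dist p.1 (y k) < del.
  by move=> Akp; exact: (subset_seqDU Akp).
have mA k : measurable (A k).
  apply: measurableD; first exact: open_borel.
  by apply: bigsetU_measurable => i _; exact: open_borel.
have tA : trivIset setT A by exact: trivIset_seqDU.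
have AN : \big[setU/set0]_(0 <= k < N) A k = setT.
  rewrite big_mkord -bigsetU_seqDU; apply/seteqP; split=> // p _.
  have [k [kN xk yk]] := cov p.
  by rewrite -bigcup_mkord; exists k.

have /choice[kp kpP] : forall p : T * T, exists k, (k < N)%N /\ A k p.
  move=> p; have : (\big[setU/set0]_(0 <= k < N) A k) p by rewrite AN.
  by rewrite big_mkord -bigcup_mkord => -[k /= kN Akp]; exists k.
have kpA k : [set p | kp p = k] = A k.
  apply/seteqP; split=> [p /= <-|p Akp]/=; first by have [] := kpP p.
  apply: (tA _ _ Logic.I Logic.I); exists p; split=> //.
  by have [] := kpP p.
have kpx p : dist (x (kp p)) p.2 < del.
  by have [_ /AU[]] := kpP p.
have kpy p : dist p.1 (y (kp p)) < del.
  by have [_ /AU[]] := kpP p.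
have mkp k : measurable ([set p | kp p = k] : set (borel (T * T)%type)).
  by rewrite kpA.
pose g2 (p : T * T) := (x (kp p), p.2).
pose g1 (p : T * T) := (p.1, y (kp p)).
have mg2 : measurable_fun setT (g2 : borel (T * T)%type -> borel (T * T)%type).
  apply: (@measurable_fun_glue _ _ kp (fun k p => (x k, p.2)) mkp) => k p.
  by apply: cvg_pair; [exact: cvg_cst|exact: cvg_snd].
have mg1 : measurable_fun setT (g1 : borel (T * T)%type -> borel (T * T)%type).
  apply: (@measurable_fun_glue _ _ kp (fun k p => (p.1, y k)) mkp) => k p.
  by apply: cvg_pair; [exact: cvg_fst|exact: cvg_cst].
have Pfin B : measurable B -> Psi B \is a fin_num.
  by move=> mB; exact: fin_num_measure.
pose b k := fine (Psi (A k)).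
have bE k : (b k)%:E = Psi (A k) by rewrite fineK ?Pfin.
have b0 k : 0 <= b k by rewrite fine_ge0.
exists b; split=> //.
  (* On cell [k], the path through [p.2] and [p.1] gives [dist (x k) (y k) < dist p.1 p.2 + 2 *
     del]; this is integrated and summed over the cells. *)
  apply: (@le_trans _ _ (\int[Psi]_p ((dist p.1 p.2)%:E + (2 * del)%:E))%E).
    rewrite -AN ge0_integral_bigsetU//; first last.
    - by move=> p _; rewrite -EFinD lee_fin addr_ge0 ?dist_ge0// mulr_ge0// ltW.
    - apply: measurable_funTS; apply: emeasurable_funD => //.
      exact: measurable_dist.
    - by move=> i j _ _; exact: tA.
    - exact: iota_uniq.
    rewrite -sumEFin; apply: lee_sum => k _.
    rewrite EFinM bE muleC -integral_cst//; apply: ge0_le_integral => //.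
    - by move=> p _; rewrite lee_fin dist_ge0.
    - apply: measurable_funTS; apply: emeasurable_funD => //.
      exact: measurable_dist.
    - move=> p /AU[xp yp]; rewrite -EFinD lee_fin.
      have := dist_triangle cm (x k) p.2 (y k).
      have := dist_triangle cm p.2 p.1 (y k).
      rewrite (dist_sym cm p.2 p.1); lra.
  rewrite ge0_integralD//; first last.
  - by move=> p _; rewrite lee_fin mulr_ge0// ltW.
  - exact: measurable_dist.
  - by move=> p _; rewrite lee_fin dist_ge0.
  by rewrite leeD2l// integral_cst.
move=> nu nuE.
(* The first marginal of the [g2] part and the second one of the [g1] part are the sums of [b k]
   times Dirac masses at [x k] and at [y k]. The other two are the marginals of [Psi], whose
   difference is [mu]. *)
pose Phi : {finite_measure set (borel (T * T)%type) -> \bar R} :=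
  pushforward_add Psi mg2 mg1.
have PhiE B : Phi B = (Psi (g2 @^-1` B) + Psi (g1 @^-1` B))%E.
  exact: pushforward_addE.
(* Split over the cells: the trace on cell [k] is the whole cell or empty, according to whether
   [z k] lies in [E]. *)
have sumE (z : nat -> T) (E : set (borel T)) :
    Psi [set p | E (z (kp p))] =
    (\sum_(0 <= k < N) (b k)%:E * \d_(z k : borel T) E)%E.
  pose B k : set (borel (T * T)%type) := A k `&` [set _ | E (z k)].
  have BE k : E (z k) /\ B k = A k \/ ~ E (z k) /\ B k = set0.
    have [Ez|nEz] := pselect (E (z k)); [left|right]; split=> //.
      by apply/seteqP; split=> [p []|p].
    by apply/seteqP; split=> [p []|p].
  have mB k : measurable (B k) by have [[_ ->]|[_ ->]] := BE k.
  have -> : [set p | E (z (kp p))] = \big[setU/set0]_(k < N) B k.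
    rewrite -bigcup_mkord; apply/seteqP; split=> [p /= Ep|p [k kN [+ Ek]]].
      by have [kN Ap] := kpP p; exists (kp p).
    by rewrite -kpA => /= ->.
  rewrite big_mkord measure_semi_additive//; last exact: bigsetU_measurable.
    apply: eq_bigr => k _; rewrite bE diracE.
    have [[Ez ->]|[nEz ->]] := BE k; first by rewrite mem_set// mule1.
    by rewrite memNset// mule0 measure0.
  by move=> i j _ _ [p [[Ai _] [Aj _]]]; apply: (tA _ _ Logic.I Logic.I); exists p.
have pPhi : plans nu Phi.
  move=> E mE; rewrite !PhiE (nuE _ mE) -(pPsi _ mE).
  have mTE : measurable (setT `*` E : set (borel (T * T)%type)).
    rewrite (_ : _ `*` _ = setT `&` snd @^-1` E).
      exact: measurable_snd_borel.
    by apply/seteqP; split=> [p []|p []].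
  have mET : measurable (E `*` setT : set (borel (T * T)%type)).
    rewrite (_ : _ `*` _ = setT `&` fst @^-1` E).
      exact: measurable_fst_borel.
    by apply/seteqP; split=> [p []|p []].
  have -> : g2 @^-1` (setT `*` E) = setT `*` E by [].
  have -> : g1 @^-1` (E `*` setT) = E `*` setT by [].
  have -> : Psi (g2 @^-1` (E `*` setT)) =
      (\sum_(0 <= k < N) (b k)%:E * \d_(x k : borel T) E)%E.
    rewrite -(sumE x E); congr (Psi _).
    by apply/seteqP; split=> [p []|p].
  have -> : Psi (g1 @^-1` (setT `*` E)) =
      (\sum_(0 <= k < N) (b k)%:E * \d_(y k : borel T) E)%E.
    rewrite -(sumE y E); congr (Psi _).
    by apply/seteqP; split=> [p []|p].
  rewrite -(fineK (Pfin _ mTE)) -(fineK (Pfin _ mET)).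
  under eq_bigr do rewrite diracE -EFinM.
  under [in X in (_ - X)%E]eq_bigr do rewrite diracE -EFinM.
  under [in RHS]eq_bigr do rewrite !diracE -EFinB -EFinM mulrBr.
  rewrite !sumEFin -!(EFinB, EFinD) sumrB; congr (_%:E); ring.
apply: (le_trans (KR_le pPhi)).
have mdist := measurable_dist.
have dge0 (p : borel (T * T)%type) : (0 <= (dist p.1 p.2)%:E)%E.
  by rewrite lee_fin dist_ge0.
have -> : (\int[Phi]_p (dist p.1 p.2)%:E =
   \int[Psi]_p (dist (g2 p).1 (g2 p).2)%:E +
   \int[Psi]_p (dist (g1 p).1 (g1 p).2)%:E)%E.
  rewrite [LHS](ge0_integral_measure_add (pushforward_measure Psi mg2)
    (pushforward_measure Psi mg1))//.
  congr (_ + _)%E.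
  - exact: (ge0_integral_pushforward mg2).
  - exact: (ge0_integral_pushforward mg1).
(* Applied to [g1] and to [g2], each of which contributes one half of [2 * del]. *)
have le_del (g : borel (T * T)%type -> borel (T * T)%type) :
    measurable_fun setT g ->
    (forall p, dist (g p).1 (g p).2 < del) ->
    (\int[Psi]_p (dist (g p).1 (g p).2)%:E <= del%:E * Psi setT)%E.
  move=> mg gdel; rewrite -integral_cst//; apply: ge0_le_integral => //.
  - exact: (measurableT_comp mdist mg).
  - by move=> p _; rewrite lee_fin ltW.
rewrite mulr_natl mulr2n EFinD muleDl//; last by rewrite Pfin.
by apply: leeD; apply: le_del.
Qed.

End transport.

(** * Approximation in the completion by finite combinations of dipoles *)

Section completion.
Context (R : realType) (T : ptopologicalType) (dist : T -> T -> R).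
Context (cm : continuous_metric dist).
Context (V : completeNormedModType R) (iota : charge (borel T) R -> V).
Context (iotaP : KR_completion dist iota).

Local Notation M := (charge (borel T) R).

(** Realizes a finite combination in [V] by a charge with known values, to which estimates of [KR]
    apply. *)
Lemma iota_sum (m : nat -> M) (c : nat -> R) (N : nat) :
  (forall j, M0 (m j)) -> exists nu : M,
  [/\ M0 nu, iota nu = \sum_(0 <= j < N) c j *: iota (m j)
    & forall E, nu E = (\sum_(0 <= j < N) (c j)%:E * m j E)%E].
Proof.
move=> m0.
have Z0 (a : R) (mu : M) : M0 mu -> M0 (cscale a mu : M).
  by move=> mu0; rewrite /M0/= /cscale mu0 mule0.
elim: N => [|N [nu [nu0 iotanu nuE]]].
  (* A null multiple of [m 0] serves as zero charge, its image being 0 by homogeneity. *)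
  exists (cscale 0 (m 0%N)); split; first exact: Z0.
    by rewrite (KR_completionZ iotaP)// scale0r big_nil.
  by move=> E; rewrite /= /cscale mul0e big_nil.
exists (cadd nu (cscale (c N) (m N))); split.
- rewrite /M0/= /cadd/=.
  by rewrite nu0 (Z0 _ _ (m0 N)) adde0.
- rewrite (KR_completionD iotaP)//; last exact: Z0.
  by rewrite (KR_completionZ iotaP)// iotanu big_nat_recr.
- by move=> E; rewrite /= /cadd/= nuE big_nat_recr.
Qed.

(** The error is shared out in quarters of [e]: one to replace [v] by some [iota mu], one for the
    near-optimality of the plan [Psi], one for rounding [Psi]. The first and the last bound the
    residual; all three enter the size of the coefficients. *)
Lemma dipole_approx (x y : nat -> T) :
  (forall j, 0 < dist (x j) (y j)) ->
  (forall del, 0 < del -> exists N : nat, forall p : T * T,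
     exists k, [/\ (k < N)%N, dist (x k) p.2 < del & dist p.1 (y k) < del]) ->
  let m j : M := dipole (dist (x j) (y j))^-1 (x j) (y j) in
  forall (v : V) (e : R), 0 < e -> exists (N : nat) (c : nat -> R),
     [/\ forall j, (N <= j)%N -> c j = 0,
         \sum_(0 <= j < N) `|c j| <= `|v| + e
       & `|v - \sum_(0 <= j < N) c j *: iota (m j)| <= e].
Proof.
move=> dxy cov m v e e0.
have m0 j : M0 (m j) by exact: dipole_M0.
have e4 : 0 < e / 4 by rewrite divr_gt0.
have [z [/interior_subset vz [mu mu0 zmu]]] :
    (ball v (e / 4))^° `&` (iota @` @M0 R T) !=set0.
  apply: (KR_completion_dense iotaP); last exact: open_interior.
  by exists v; apply: nbhsx_ballx.
have vmu : `|v - iota mu| < e / 4 by move: vz; rewrite -zmu -ball_normE.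
have [_ [Psi pPsi <-] costPsi] : exists2 r, [set (\int[Psi]_p (dist p.1 p.2)%:E)%E |
    Psi in plans mu] r & (r < (`|iota mu| + e / 4)%:E)%E.
  apply: ereal_inf_lt; rewrite -/(KR dist mu) -(KR_completion_norm iotaP)//.
  by rewrite lte_fin ltrDl.
have Pfin : Psi setT \is a fin_num by exact: fin_num_measure.
pose P := fine (Psi setT).
have P0 : 0 <= P by rewrite fine_ge0.
(* Gives [2 * del * P = (e / 4) * (P / (P + 1))]; the [P + 1] guards against [P = 0]. *)
pose del := e / 4 / (2 * (P + 1)).
have P1 : 0 < 2 * (P + 1) by rewrite mulr_gt0// ltr_wpDl.
have del0 : 0 < del by rewrite divr_gt0.
have [N covN] := cov _ del0.
have [b [b0 bcost bKR]] := plan_discretize cm del0 pPsi covN.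
have delP : ((2 * del)%:E * Psi setT <= (e / 4)%:E)%E.
  rewrite -(fineK Pfin) -/P -EFinM lee_fin.
  have : del * (2 * (P + 1)) = e / 4 by rewrite divfK ?gt_eqF.
  lra.
(* Since [m j] is divided by the distance, the weight [b j] is multiplied by it, and the sum of the
   [c j] is the cost of the rounded plan. *)
pose c j := if (j < N)%N then b j * dist (x j) (y j) else 0.
have [nu [nu0 iotanu nuE]] := iota_sum c N m0.
exists N, c; split.
- by move=> j; rewrite leqNgt /c => /negbTE ->.
- have : (((\sum_(0 <= k < N) b k * dist (x k) (y k))%:E) <=
      (`|iota mu| + e / 4)%:E + (e / 4)%:E)%E.
    by apply: (le_trans bcost); apply: leeD => //; exact: ltW.
  rewrite -EFinD lee_fin => h.
  have -> : \sum_(0 <= j < N) `|c j| = \sum_(0 <= k < N) b k * dist (x k) (y k).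
    apply: eq_big_nat => j /andP[_ jN]; rewrite /c jN ger0_norm//.
    by rewrite mulr_ge0// dist_ge0.
  apply: (le_trans h).
  have := ler_normB v (v - iota mu); rewrite opprB addrCA subrr addr0; lra.
- rewrite -iotanu.
  have Nnu0 : M0 (cscale (-1) nu : M) by rewrite /M0/= /cscale nu0 mule0.
  have KRnu : (KR dist (cadd mu (cscale (-1) nu)) <= (e / 4)%:E)%E.
    apply: le_trans delP; apply: bKR => E mE.
    rewrite /= /cadd/=; congr (_ + _)%E.
    rewrite /= /cscale EFinN mulN1e nuE; congr (- _)%E.
    apply: eq_big_nat => j /andP[_ jN].
    rewrite /m dipoleE muleA -EFinM /c jN mulfK// gt_eqF//.
  have : M0 (cadd mu (cscale (-1) nu) : M).
    by rewrite /M0/= /cadd/=; rewrite mu0 Nnu0 adde0.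
  move=> /(KR_completion_norm iotaP); rewrite (KR_completionD iotaP)//.
  rewrite (KR_completionZ iotaP)// scaleN1r => normE.
  move: KRnu; rewrite -normE lee_fin => h.
  have := ler_normD (v - iota mu) (iota mu - iota nu).
  rewrite addrA subrK; lra.
Qed.

End completion.

(** * Support of a dipole *)

Section dipole_support.
Context (R : realType) (T : ptopologicalType) (dist : T -> T -> R).
Context (cm : continuous_metric dist).
Context (sep : forall x y, dist x y = 0 -> x = y).

Lemma dist_gt0 x y : x <> y -> 0 < dist x y.
Proof.
by move=> xy; rewrite lt_neqAle dist_ge0// andbT eq_sym; apply/eqP => /sep.
Qed.

Lemma dist_gt0_open y : open [set w | 0 < dist w y].
Proof.
rewrite (_ : mkset _ = (dist ^~ y) @^-1` [set r | 0 < r])//.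
apply: open_comp; last exact: open_gt.
by move=> w _; exact: dist_continuousl.
Qed.

(** Removing [y] from an open neighbourhood of [x] leaves an open set of charge [a], and
    symmetrically [- a] at [y]; sets avoiding both points have charge 0. *)
Lemma supp_dipole (a : R) x y : a != 0 -> x <> y ->
  @supp R T (dipole a x y) = [set x; y].
Proof.
move=> a0 xy.
have yx : y <> x by move=> /esym.
have off z (U : set T) : open U ->
    measurable (U `&` [set u | 0 < dist u z] : set (borel T)).
  by move=> oU; apply: open_borel; apply: openI => //; exact: dist_gt0_open.
have notin z (U : set T) : z \in (U `&` [set u | 0 < dist u z]) = false.
  by apply: memNset => -[_]/=; rewrite (dist_refl cm) ltxx.
apply/seteqP; split=> [z sz|z [] -> U oU Uz nullU].
- apply: contrapT => /not_orP[zx zy].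
  apply: (sz ([set w | 0 < dist w x] `&` [set w | 0 < dist w y])).
  + by apply: openI; exact: dist_gt0_open.
  + by split; exact: dist_gt0.
  + move=> A mA Asub; rewrite dipoleE !diracE !memNset ?subee ?mule0//.
      by move=> /Asub[_]/=; rewrite (dist_refl cm) ltxx.
    by move=> /Asub[]/=; rewrite (dist_refl cm) ltxx.
- have := nullU _ (off y U oU) (@subIsetl _ _ _).
  rewrite dipoleE !diracE notin mem_set; last by split=> //; exact: dist_gt0.
  by rewrite sube0 mule1 => -[] /eqP; rewrite (negbTE a0).
- have := nullU _ (off x U oU) (@subIsetl _ _ _).
  rewrite dipoleE !diracE notin mem_set; last by split=> //; exact: dist_gt0.
  by rewrite sub0e muleN mule1 => -[] /eqP; rewrite oppr_eq0 (negbTE a0).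
Qed.

End dipole_support.

Lemma card_set2 (T : Type) (x y : T) : x <> y -> ([set x; y] #= `I_2)%card.
Proof.
move=> xy; apply/eq_cardSP; exists x; first by left.
rewrite (_ : _ `\` _ = [set y]); first exact: card_set1.
apply/seteqP; split=> [z [+ zx]|z ->]; first by case=> // /zx.
by split; [right|move=> /esym].
Qed.

(** * Triangle inequality and continuity of the Euclidean distance *)

Section euclidean.
Context (R : realType) (n : nat).
Implicit Types a b : 'I_n -> R.

Lemma sqrt_sumsq_eq0 a : Num.sqrt (\sum_i a i ^+ 2) = 0 -> forall i, a i = 0.
Proof.
have a2 : forall i : 'I_n, true -> 0 <= a i ^+ 2 by move=> i _; exact: sqr_ge0.
move=> /eqP; rewrite sqrtr_eq0 => a0 i.
have /(psumr_eq0P a2)/(_ i isT)/eqP : \sum_i a i ^+ 2 = 0.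
  by apply/eqP; rewrite eq_le a0 sumr_ge0.
by rewrite sqrf_eq0 => /eqP.
Qed.

Lemma sqrt_sumsq_triangle a b :
  Num.sqrt (\sum_i (a i + b i) ^+ 2) <=
  Num.sqrt (\sum_i a i ^+ 2) + Num.sqrt (\sum_i b i ^+ 2).
Proof.
set s := Num.sqrt (\sum_i a i ^+ 2); set t := Num.sqrt (\sum_i b i ^+ 2).
have s0 : 0 <= s by exact: sqrtr_ge0.
have t0 : 0 <= t by exact: sqrtr_ge0.
have sE : s ^+ 2 = \sum_i a i ^+ 2.
  by rewrite sqr_sqrtr// sumr_ge0// => i _; exact: sqr_ge0.
have tE : t ^+ 2 = \sum_i b i ^+ 2.
  by rewrite sqr_sqrtr// sumr_ge0// => i _; exact: sqr_ge0.
(* The cases [s = 0] and [t = 0] are settled first because the proof of [CS] divides by [s * t]. *)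
have [s00|sN0] := eqVneq s 0.
  rewrite s00 add0r /t le_eqVlt; apply/orP; left; apply/eqP.
  by congr (Num.sqrt _); apply: eq_bigr => i _; rewrite (sqrt_sumsq_eq0 s00) add0r.
have [t00|tN0] := eqVneq t 0.
  rewrite t00 addr0 /s le_eqVlt; apply/orP; left; apply/eqP.
  by congr (Num.sqrt _); apply: eq_bigr => i _; rewrite (sqrt_sumsq_eq0 t00) addr0.
have st0 : 0 < s * t by rewrite mulr_gt0// lt_neqAle eq_sym ?sN0 ?tN0.
have CS : \sum_i a i * b i <= s * t.
  (* Cauchy-Schwarz: this sum equals [2 * (s * t) * (s * t - \sum_i a i * b i)]. *)
  have : 0 <= \sum_i (t * a i - s * b i) ^+ 2.
    by apply: sumr_ge0 => i _; exact: sqr_ge0.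
  have -> : \sum_i (t * a i - s * b i) ^+ 2 =
      t ^+ 2 * \sum_i a i ^+ 2 - 2 * (s * t) * (\sum_i a i * b i) +
      s ^+ 2 * \sum_i b i ^+ 2.
    rewrite !mulr_sumr -sumrB -big_split/=; apply: eq_bigr => i _; ring.
  rewrite -sE -tE => h; rewrite -(ler_pM2l st0); lra.
rewrite -(ler_pXn2r (n := 2))// ?nnegrE ?sqrtr_ge0 ?addr_ge0//.
rewrite sqr_sqrtr; last by apply: sumr_ge0 => i _; exact: sqr_ge0.
have -> : \sum_i (a i + b i) ^+ 2 =
    \sum_i a i ^+ 2 + 2 * (\sum_i a i * b i) + \sum_i b i ^+ 2.
  rewrite mulr_sumr -!big_split/=; apply: eq_bigr => i _; ring.
rewrite -sE -tE; lra.
Qed.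

Lemma euclid_dist_continuous :
  continuous (fun p : 'rV[R]_n * 'rV[R]_n => euclid_dist p.1 p.2).
Proof.
move=> p; apply: (@continuous_comp _ _ _
  (fun p : 'rV[R]_n * 'rV[R]_n => \sum_(i < n) (p.1 ord0 i - p.2 ord0 i) ^+ 2)
  (@Num.sqrt R)); last exact: sqrt_continuous.
apply: continuous_big; first exact: add_continuous.
move=> i _ q.
have c : continuous (fun q : 'rV[R]_n * 'rV[R]_n => q.1 ord0 i - q.2 ord0 i).
  move=> {}q; apply: cvgB.
  - apply: (@continuous_comp _ _ _ fst (fun u : 'rV[R]_n => u ord0 i)).
      exact: cvg_fst.
    exact: coord_continuous.
  - apply: (@continuous_comp _ _ _ snd (fun u : 'rV[R]_n => u ord0 i)).
      exact: cvg_snd.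
    exact: coord_continuous.
by apply: cvgM; exact: c.
Qed.

End euclidean.

(** * The closure of Omega as a compact metric space *)

Section closure_metric.
Context (R : realType) (n : nat) (Omega : set 'rV[R]_n).
Context (Omega0 : Omega !=set0).

Local Notation K := (closure_type Omega0).
Local Notation d := (@kdist R n Omega Omega0).

Lemma val_continuous : continuous (fun z : K => \val z : 'rV[R]_n).
Proof. exact: (@initial_continuous (closure Omega) 'rV[R]_n set_val). Qed.

Lemma kdist_metric : continuous_metric d.
Proof.
split.
- move=> x; rewrite /kdist /euclid_dist big1 ?sqrtr0// => i _.
  by rewrite subrr expr0n.
- move=> x y; rewrite /kdist /euclid_dist; congr (Num.sqrt _).
  by apply: eq_bigr => i _; rewrite -sqrrN opprB.
- move=> x y z; rewrite /kdist /euclid_dist.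
  apply: le_trans (sqrt_sumsq_triangle _ _).
  rewrite le_eqVlt; apply/orP; left; apply/eqP; congr (Num.sqrt _).
  by apply: eq_bigr => i _; rewrite addrA subrK.
- move=> p; apply: (@continuous_comp _ _ _ (fun p : K * K =>
    ((\val p.1, \val p.2) : 'rV[R]_n * 'rV[R]_n)%type)
    (fun q => euclid_dist q.1 q.2)); last exact: euclid_dist_continuous.
  have cv1 : (\val q.1 : 'rV[R]_n) @[q --> p] --> (\val p.1 : 'rV[R]_n).
    by apply: (@continuous_comp _ _ _ fst (fun z : K => \val z : 'rV[R]_n));
      [exact: cvg_fst|exact: val_continuous].
  have cv2 : (\val q.2 : 'rV[R]_n) @[q --> p] --> (\val p.2 : 'rV[R]_n).
    by apply: (@continuous_comp _ _ _ snd (fun z : K => \val z : 'rV[R]_n));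
      [exact: cvg_snd|exact: val_continuous].
  exact: (cvg_pair cv1 cv2).
Qed.

Lemma kdist_eq0 (x y : K) : d x y = 0 -> x = y.
Proof.
move=> /sqrt_sumsq_eq0 xy; apply: val_inj; apply/rowP => i.
by apply/eqP; rewrite -subr_eq0; apply/eqP; exact: xy.
Qed.

Lemma closure_compact : bounded_set Omega -> compact (closure Omega).
Proof.
move=> [M [_ OmegaM]]; apply: bounded_closed_compact; last exact: closed_closure.
exists (M + 1); split; first exact: num_real.
move=> r Mr z; rewrite closureE => /(_ [set u | `|u| <= r]) /=; apply.
split; last by move=> u Ou; apply: OmegaM => //; rewrite (lt_trans _ Mr)// ltrDl.
apply: (@closed_comp _ _ (fun u : 'rV[R]_n => `|u|) [set t | t <= r]).
  by move=> u _; exact: norm_continuous.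
exact: closed_le.
Qed.

(** Compactness of the product of the closures. The open cover lives in the ambient product of
    Euclidean spaces and is read back on pairs of [K] at the end. *)
Lemma finite_pair_cover (x y : nat -> K) : bounded_set Omega ->
  (forall (p : K * K) del, 0 < del ->
     exists k, d (x k) p.2 < del /\ d p.1 (y k) < del) ->
  forall del, 0 < del -> exists N : nat, forall p : K * K,
     exists k, [/\ (k < N)%N, d (x k) p.2 < del & d p.1 (y k) < del].
Proof.
move=> bO pdense del del0.
have cK := closure_compact bO.
have := compact_setX cK cK; rewrite compact_cover.
pose W k := [set q : 'rV[R]_n * 'rV[R]_n |
  euclid_dist (\val (x k)) q.2 < del /\ euclid_dist q.1 (\val (y k)) < del].
move=> /(_ nat setT W)[k _|q [q1 q2]|D' _ cov].
- apply: openI.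
  + apply: (@open_comp _ _ (fun q : 'rV[R]_n * 'rV[R]_n =>
      euclid_dist (\val (x k)) q.2) [set t | t < del]); last exact: open_lt.
    move=> q _; apply: (@continuous_comp _ _ _ (fun q : 'rV[R]_n * 'rV[R]_n =>
      (\val (x k), q.2)) (fun q => euclid_dist q.1 q.2)).
      exact: (cvg_pair (cvg_cst _) cvg_snd).
    exact: euclid_dist_continuous.
  + apply: (@open_comp _ _ (fun q : 'rV[R]_n * 'rV[R]_n =>
      euclid_dist q.1 (\val (y k))) [set t | t < del]); last exact: open_lt.
    move=> q _; apply: (@continuous_comp _ _ _ (fun q : 'rV[R]_n * 'rV[R]_n =>
      (q.1, \val (y k))) (fun q => euclid_dist q.1 q.2)).
      exact: (cvg_pair cvg_fst (cvg_cst _)).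
    exact: euclid_dist_continuous.
- have [k [xk yk]] := pdense
    (exist _ q.1 (mem_set q1) : K, exist _ q.2 (mem_set q2) : K) del del0.
  by exists k.
(* One more than the largest index of the subcover, because of the strict [k < N]. *)
exists (\max_(i <- D') i).+1 => p.
have [|k /= kD [xk yk]] := cov (\val p.1, \val p.2).
  by split; apply: set_mem; exact: valP.
by exists k; split=> //; rewrite ltnS; exact: leq_bigmax_seq.
Qed.

End closure_metric.

(** * Expansion of the completion in the normalized dipoles *)

Theorem theorem3p2 (R : realType) (n : nat) (Omega : set 'rV[R]_n)
    (Omega0 : Omega !=set0) (Omega_open : open Omega)
    (Omega_bounded : bounded_set Omega)
    (D1 D2 : set (closure_type Omega0))
    (D1_countable : countable D1) (D1_dense : dense D1)
    (D2_sub : D2 `<=` ~` D1)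
    (D2_countable : countable D2) (D2_dense : dense D2)
    (x y : nat -> closure_type Omega0)
    (xy_enum : set_bij setT (D1 `*` D2) (fun j => (x j, y j)))
    (V : completeNormedModType R)
    (iota : {charge set (borel (closure_type Omega0)) -> \bar R} -> V)
    (iota_completion : KR_completion (@kdist R n Omega Omega0) iota) :
  let mu_ := fun j : nat => dipole (kdist (x j) (y j))^-1 (x j) (y j) in
  (exists C : R, 0 < C < 1 /\
     forall mu : V, exists alpha : nat -> R,
       [/\ cvgn (series (fun j => `|alpha j|)),
           series (fun j => alpha j *: iota (mu_ j)) @ \oo --> mu,
           C * limn (series (fun j => `|alpha j|)) <= `|mu|
         & `|mu| <= limn (series (fun j => `|alpha j|))]) /\
  closure (linear_span (range (fun j => iota (mu_ j)))) = setT /\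
  (forall j, KR (@kdist R n Omega Omega0) (mu_ j) = 1%E) /\
  (forall j, [/\ is_delta_atom (mu_ j), is_dipole (mu_ j)
               & (supp (mu_ j) #= `I_2)%card]).
Proof.
move=> mu_.
have cm := kdist_metric Omega0.
have sep := @kdist_eq0 R n Omega Omega0.
have xyD j : D1 (x j) /\ D2 (y j).
  have [xy_fun _ _] := xy_enum.
  by have := xy_fun j; apply.
have xy_neq j : x j <> y j.
  by have [D1x /D2_sub nD1y] := xyD j => xyj; apply: nD1y; rewrite -xyj.
have dxy j : 0 < kdist (x j) (y j) by exact: dist_gt0.
have mu0 j : M0 (mu_ j) by exact: dipole_M0.
have KR1 j : KR (@kdist R n Omega Omega0) (mu_ j) = 1%E.
  by rewrite KR_dipole ?invr_ge0 ?(ltW (dxy j))// mulVf// gt_eqF.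
have norm1 j : `|iota (mu_ j)| = 1.
  have := KR_completion_norm iota_completion (mu0 j).
  by rewrite KR1 => -[].
(* A plan carries mass from [p.1] to [p.2] while [mu_ k] is positive at [x k], so [x k] has to
   approach [p.2] and [y k] to approach [p.1]. Every pair of [D1] and [D2] is enumerated. *)
have pair_dense (p : closure_type Omega0 * closure_type Omega0) del : 0 < del ->
    exists k, kdist (x k) p.2 < del /\ kdist p.1 (y k) < del.
  move=> del0.
  have near z : open [set w : closure_type Omega0 | kdist w z < del].
    apply: (@open_comp _ _ (@kdist R n Omega Omega0 ^~ z) [set r | r < del]).
      by move=> w _; exact: (dist_continuousl cm).
    exact: open_lt.
  have self z : [set w : closure_type Omega0 | kdist w z < del] !=set0.
    by exists z; rewrite /= (dist_refl cm).
  have [a [apdel D1a]] := D1_dense _ (self p.2) (near p.2).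
  have [b [bpdel D2b]] := D2_dense _ (self p.1) (near p.1).
  have [_ _ xy_surj] := xy_enum.
  have [k _ [xk yk]] := xy_surj (a, b) (conj D1a D2b).
  by exists k; rewrite xk yk (dist_sym cm p.1).
have norm_le1 j : `|iota (mu_ j)| <= 1 by rewrite norm1.
have repr := l1_representation norm_le1 (dipole_approx cm iota_completion dxy
  (finite_pair_cover Omega_bounded pair_dense)).
split; [|split; [|split]] => //.
(* The factor 2 of [l1_representation] gives the constant; the upper bound is the triangle
   inequality on partial sums, passed to the limit. *)
- exists 2^-1; split; first by apply/andP; split; lra.
  move=> mu; have [alpha [calpha mualpha le2]] := repr mu.
  exists alpha; split=> //.
    by rewrite mulrC ler_pdivrMr// mulrC.
  have cnorm : `|series (fun j => alpha j *: iota (mu_ j)) N| @[N --> \oo] --> `|mu|.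
    exact: cvg_norm.
  rewrite -(cvg_lim _ cnorm)//; apply: ler_lim => //.
    by apply/cvg_ex; eexists; exact: cnorm.
  near=> N; apply: le_trans (ler_norm_sum _ _ _) _.
  by apply: ler_sum => j _; rewrite normrZ norm1 mulr1.
- apply/seteqP; split=> // mu _.
  have [alpha [_ mualpha _]] := repr mu.
  move=> B /mualpha[N _ /(_ N (leqnn N)) BN].
  exists (series (fun j => alpha j *: iota (mu_ j)) N); split=> //.
  exists N, (fun i => alpha i), (fun i => iota (mu_ i)); split.
    by move=> i; exists i.
  by rewrite /series/= big_mkord.
- move=> j; have a0 : (kdist (x j) (y j))^-1 != 0 by rewrite invr_eq0 gt_eqF.
  have suppE := supp_dipole cm sep a0 (xy_neq j).
  split.
  + by rewrite /is_delta_atom suppE; exact: finite_set2.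
  + by split=> //; exists (kdist (x j) (y j))^-1, (x j), (y j).
  + by rewrite suppE; exact: card_set2.
Unshelve. all: by end_near. Qed.
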